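(* Let $P$ be a $d$-dimensional reflexive polytope in $M_{\mathbb{R}}$. Then there are at most $2d$ facets of $P$ containing lattice points in their relative interior, and equality holds if and only if $P\cong[-1,1]^d$ as lattice polytopes.
   Context: $N\cong\mathbb{Z}^d$ is a lattice with dual lattice $M$; lattice points are points of $M$. A $d$-dimensional lattice polytope $P\subseteq M_{\mathbb{R}}$ with $0\in\mathrm{int}\,P$ is reflexive if its dual $P^*=\{y\in N_{\mathbb{R}}:\langle x,y\rangle\ge-1\ \forall x\in P\}$ is a lattice polytope (with respect to $N$). An isomorphism of lattice polytopes is an isomorphism of the associated lattices whose induced real linear isomorphism maps the polytopes onto each other; $[-1,1]^d$ is taken with respect to the lattice $\mathbb{Z}^d$. *)

(* Defs.v *)
From HB Require Import structures.
From mathcomp Require Import all_boot all_order all_algebra.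
From mathcomp Require Import all_classical all_reals all_analysis.

Set Implicit Arguments.
Unset Strict Implicit.
Unset Printing Implicit Defensive.

Import Order.TTheory GRing.Theory Num.Theory.
Import numFieldNormedType.Exports.

Local Open Scope classical_set_scope.
Local Open Scope ring_scope.

Section ConvexGeometry.
Variables (R : realType) (d : nat).
Implicit Types (S P F : set 'rV[R]_d).

Definition pairing (x y : 'rV[R]_d) : R := \sum_(i < d) x 0 i * y 0 i.

Definition affine_hull S : set 'rV[R]_d :=
  [set x | exists n (p : 'I_n -> 'rV[R]_d) (a : 'I_n -> R),
     [/\ forall i, S (p i), \sum_(i < n) a i = 1
       & x = \sum_(i < n) a i *: p i]].

Definition convex_hull S : set 'rV[R]_d :=
  [set x | exists n (p : 'I_n -> 'rV[R]_d) (a : 'I_n -> R),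
     [/\ forall i, S (p i), forall i, 0 <= a i, \sum_(i < n) a i = 1
       & x = \sum_(i < n) a i *: p i]].

(* No k satisfies this for the empty set (whose dimension is -1). *)
Definition has_dim S (k : nat) : Prop :=
  exists (p : 'rV[R]_d) (A : 'M[R]_(k, d)),
    row_free A /\ affine_hull S = [set p + v | v in [set v | (v <= A)%MS]].

(* Points of the affine hull some neighbourhood of which meets the affine hull
   inside S; such points belong to S. *)
Definition relative_interior S : set 'rV[R]_d :=
  [set x | affine_hull S x /\ \forall y \near x, affine_hull S y -> S y].

(* The trivial faces P (u = 0, c = 0) and set0 (u = 0, c = 1) are included. *)
Definition is_face P F : Prop :=
  exists (u : 'rV[R]_d) (c : R),
    (forall x, P x -> pairing x u <= c) /\
    F = [set x | P x /\ pairing x u = c].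

(* For d = 0 there is no facet in this sense: it would have dimension -1, i.e.
   be the empty face, which contains no point anyway. *)
Definition is_facet P F : Prop :=
  is_face P F /\ exists k, k.+1 = d /\ has_dim F k.

Definition polar_dual P : set 'rV[R]_d :=
  [set y | forall x, P x -> -1 <= pairing x y].

Definition cube : set 'rV[R]_d := [set x | forall i, -1 <= x 0 i <= 1].

End ConvexGeometry.

Section Lattices.
Variables (R : realType) (d : nat).
Implicit Types (L N M P : set 'rV[R]_d).

Definition std_lattice : set 'rV[R]_d :=
  [set z | forall i, z 0 i \is a Num.int].

(* L is the Z-span of the rows of B, which form a basis of R^d. *)
Definition is_lattice L : Prop :=
  exists2 B : 'M[R]_d, B \in unitmx & L = [set z *m B | z in std_lattice].

(* When N is a lattice in N_R = R^d and M_R = R^d is identified with the dual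
   space of N_R by the pairing, this is M = Hom(N, Z). *)
Definition dual_lattice N : set 'rV[R]_d :=
  [set x | forall y, N y -> pairing x y \is a Num.int].

Definition lattice_polytope L P : Prop :=
  exists V, [/\ finite_set V, V `<=` L & P = convex_hull V].

(* P is a polytope in M_R, where M is the dual lattice of N. *)
Definition reflexive_polytope N P : Prop :=
  [/\ lattice_polytope (dual_lattice N) P, has_dim P d, interior P 0
    & lattice_polytope N (polar_dual P)].

(* As L spans R^d, an isomorphism of L onto L' is the same thing as a linear
   automorphism of R^d mapping L onto L'. *)
Definition polytope_iso L P L' P' : Prop :=
  exists f : {linear 'rV[R]_d -> 'rV[R]_d},
    [/\ bijective f, f @` L = L' & f @` P = P'].

Definition facets_with_interior_lattice_points M P : set (set 'rV[R]_d) :=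
  [set F | is_facet P F /\ exists2 m, M m & relative_interior F m].

End Lattices.

(* Main.v *)
Require Import Defs.
From mathcomp Require Import all_boot all_order all_algebra.
From mathcomp Require Import all_classical all_reals all_analysis.
From mathcomp Require Import lra.

(* Write each facet containing an interior lattice point m_i as <-, u_i> = -1,
   with u_i a vertex of the dual polytope P*.  Then <m_i, u_i> = -1, while
   <m_i, w> is a nonnegative integer for every other vertex w of P*.  Since
   only 0 pairs nonnegatively with all of P*, the m_i sum to 0 over every set
   S of indices in which each i has some j in S with <m_j, u_i> > 0; the
   positive support of any linear relation between the m_i is such a set.
   Hence an inclusion-maximal set T of indices without nonempty zero-sum
   subset indexes linearly independent vectors, so |T| <= d, and each i
   outside T lies in a zero-sum subset of T + i; these are pairwise disjoint,
   so at most |T| indices lie outside T.  If there are 2d facets, the zero-sum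
   sets are pairs {i, j} with m_i = - m_j, so that (m_j) and (- u_j), for j in
   T, are dual lattice bases and P lies in the cube they define; integrality
   forces P to contain all the vertices of that cube. *)

Set Implicit Arguments.
Unset Strict Implicit.
Unset Printing Implicit Defensive.

Import Order.TTheory GRing.Theory Num.Theory.
Import numFieldNormedType.Exports.

Local Open Scope classical_set_scope.
Local Open Scope card_scope.
Local Open Scope ring_scope.

(** * Pairing, hulls and neighbourhoods *)

Lemma intr_ltD1 (R : archiRealDomainType) (x y : R) :
  x \is a Num.int -> y \is a Num.int -> x < y -> x + 1 <= y.
Proof. by move=> /intrP[a ->] /intrP[b ->]; rewrite ltr_int -intrD1 ler_int lezD1. Qed.

Section Pairing.
Variables (R : realType) (d : nat).
Implicit Types (x y u v : 'rV[R]_d) (S : set 'rV[R]_d).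

Lemma pairingC x y : pairing x y = pairing y x.
Proof. by apply: eq_bigr => i _; rewrite mulrC. Qed.

Lemma pairingDl x y u : pairing (x + y) u = pairing x u + pairing y u.
Proof. by rewrite -big_split; apply: eq_bigr => i _; rewrite mxE mulrDl. Qed.

Lemma pairingZl a x u : pairing (a *: x) u = a * pairing x u.
Proof. by rewrite mulr_sumr; apply: eq_bigr => i _; rewrite mxE mulrA. Qed.

Lemma pairingNl x u : pairing (- x) u = - pairing x u.
Proof. by rewrite -scaleN1r pairingZl mulN1r. Qed.

Lemma pairingBl x y u : pairing (x - y) u = pairing x u - pairing y u.
Proof. by rewrite pairingDl pairingNl. Qed.

Lemma pairing0l u : pairing 0 u = 0.
Proof. by rewrite -(scale0r 0) pairingZl mul0r. Qed.

Lemma pairing_suml (I : Type) (r : seq I) (P : pred I) (F : I -> 'rV[R]_d) u :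
  pairing (\sum_(i <- r | P i) F i) u = \sum_(i <- r | P i) pairing (F i) u.
Proof.
apply: (big_morph (fun x => pairing x u)); last exact: pairing0l.
by move=> x y; rewrite pairingDl.
Qed.

Lemma pairingZr a x u : pairing x (a *: u) = a * pairing x u.
Proof. by rewrite pairingC pairingZl pairingC. Qed.

Lemma pairingNr x u : pairing x (- u) = - pairing x u.
Proof. by rewrite pairingC pairingNl pairingC. Qed.

Lemma pairingBr x u v : pairing x (u - v) = pairing x u - pairing x v.
Proof. by rewrite pairingC pairingBl !(pairingC x). Qed.

Lemma pairing_sumr (I : Type) (r : seq I) (P : pred I) (F : I -> 'rV[R]_d) x :
  pairing x (\sum_(i <- r | P i) F i) = \sum_(i <- r | P i) pairing x (F i).
Proof. by rewrite pairingC pairing_suml; apply: eq_bigr => i _; apply: pairingC. Qed.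

Lemma pairing_mulmx x u : pairing x u = (x *m u^T) 0 0.
Proof. by rewrite mxE; apply: eq_bigr => i _; rewrite mxE. Qed.

Lemma pairing_row m (A : 'M[R]_(m, d)) x i : pairing x (row i A) = (x *m A^T) 0 i.
Proof. by rewrite mxE; apply: eq_bigr => j _; rewrite !mxE. Qed.

Lemma pairing_self_le0 x : pairing x x <= 0 -> x = 0.
Proof.
move=> x0; apply/rowP => i; rewrite mxE; apply/eqP; rewrite -sqrf_eq0 eq_le sqr_ge0 andbT.
apply: le_trans x0; rewrite /pairing (bigD1 i) //= expr2 lerDl sumr_ge0 // => j _.
by rewrite -expr2 sqr_ge0.
Qed.

Lemma affine_hull_line S x y (a : R) : S x -> S y ->
  affine_hull S (x + a *: (y - x)).
Proof.
move=> Sx Sy.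
exists 2%N, (fun i => if i == 0 then x else y), (fun i => if i == 0 then 1 - a else a).
split; first by move=> i; case: ifP.
  by rewrite !big_ord_recl big_ord0 /= addr0 subrK.
rewrite !big_ord_recl big_ord0 /= addr0 scalerBr scalerBl scale1r.
by rewrite -addrA [a *: y - _]addrC.
Qed.

Lemma pairing_affine_hull S u (c : R) : (forall x, S x -> pairing x u = c) ->
  forall x, affine_hull S x -> pairing x u = c.
Proof.
move=> Sc x [n [p [a [Sp a1 ->]]]]; rewrite pairing_suml.
under eq_bigr => i _ do rewrite pairingZl (Sc _ (Sp i)).
by rewrite -mulr_suml a1 mul1r.
Qed.

Lemma sub_convex_hull S : S `<=` convex_hull S.
Proof.
move=> x Sx; exists 1%N, (fun=> x), (fun=> 1).
by rewrite !big_ord1 scale1r; split.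
Qed.

Lemma pairing_convex_hull S u (c : R) : (forall x, S x -> c <= pairing x u) ->
  forall x, convex_hull S x -> c <= pairing x u.
Proof.
move=> Sc x [n [p [a [Sp a0 a1 ->]]]]; rewrite pairing_suml.
rewrite -[c]mul1r -a1 mulr_suml; apply: ler_sum => i _.
by rewrite pairingZl ler_wpM2l // Sc.
Qed.

Lemma convex_hull_segment S x y (t : R) : 0 <= t <= 1 ->
  convex_hull S x -> convex_hull S y -> convex_hull S (t *: x + (1 - t) *: y).
Proof.
move=> /andP[t0 t1] [n [p [a [Sp a0 a1 ->]]]] [m [q [b [Sq b0 b1 ->]]]].
exists (n + m)%N, (fun i => match fintype.split i with inl j => p j | inr j => q j end),
  (fun i => match fintype.split i with inl j => t * a j | inr j => (1 - t) * b j end).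
have sl j : fintype.split (lshift m j) = inl j by exact: (unsplitK (inl j)).
have sr j : fintype.split (rshift n j) = inr j by exact: (unsplitK (inr j)).
split.
- by move=> i; case: fintype.split.
- by move=> i; case: fintype.split => j; rewrite mulr_ge0 // subr_ge0.
- rewrite big_split_ord /=.
  under eq_bigr do rewrite sl.
  under [in X in _ + X]eq_bigr do rewrite sr.
  by rewrite -!mulr_sumr a1 b1 !mulr1 addrC subrK.
- rewrite big_split_ord /= !scaler_sumr; congr (_ + _); apply: eq_bigr => j _.
    by rewrite sl scalerA.
  by rewrite sr scalerA.
Qed.

Lemma near_line x v (A : set 'rV[R]_d) : nbhs x A ->
  exists2 e : R, 0 < e & A (x + e *: v).
Proof.
move=> /nbhs_ballP[e /= e0 eA].
have s0 : 0 < 1 + \sum_j `|v 0 j| by rewrite ltr_pwDl // sumr_ge0.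
(* The denominator exceeds the absolute value of each coordinate of [v], even for [v = 0], so no
   coordinate moves by [e] or more. *)
exists (e / (1 + \sum_j `|v 0 j|)); first by rewrite divr_gt0.
apply: eA; split=> // i j; rewrite ord1 -ball_normE /= !mxE opprD addNKr normrN normrM.
rewrite gtr0_norm ?divr_gt0 // mulrAC ltr_pdivrMr // ltr_pM2l //.
rewrite (bigD1 j) //= addrCA ltrDl ltr_pwDl // sumr_ge0 //.
Qed.

Lemma near_pairing_lt x u (c : R) : pairing x u < c -> \forall y \near x, pairing y u < c.
Proof.
move=> xuc; apply/nbhs_ballP.
have s0 : 0 < 1 + \sum_j `|u 0 j| by rewrite ltr_pwDl // sumr_ge0.
set e := (c - pairing x u) / (1 + \sum_j `|u 0 j|).
have e0 : 0 < e by rewrite divr_gt0 // subr_gt0.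
exists e => //= y [_ xy].
rewrite -(subrK x y) pairingDl -ltrBrDr.
have -> : c - pairing x u = e * (1 + \sum_j `|u 0 j|) by rewrite divfK // gt_eqF.
apply: (@le_lt_trans _ _ (e * \sum_j `|u 0 j|)); last by rewrite ltr_pM2l // ltrDr.
rewrite mulr_sumr; apply: ler_sum => j _; apply: le_trans (ler_norm _) _.
rewrite normrM ler_wpM2r // ltW // !mxE distrC.
by have := xy 0 j; rewrite -ball_normE.
Qed.

End Pairing.

(** * Zero-sum sets *)

Section ZeroSums.
Variables (R : realType) (d k : nat) (u m : 'I_k -> 'rV[R]_d).
Hypothesis diag : forall i, pairing (m i) (u i) = -1.
Hypothesis offdiag_ge0 : forall i j, i != j -> 0 <= pairing (m j) (u i).
Hypothesis integral : forall i j, pairing (m j) (u i) \is a Num.int.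
(** The trace left by the polytope: testing a sum against the [u i] suffices, since in the
    application each [m j] is nonnegative on all other vertices of the polar dual. *)
Hypothesis nonneg_sum0 : forall S : {set 'I_k},
  (forall i, 0 <= \sum_(j in S) pairing (m j) (u i)) -> \sum_(j in S) m j = 0.

(** Paired with [u i], the relation has the negative term [- c i], so some other term is positive;
    pairings off the diagonal are nonnegative, hence both factors of that term are positive. *)
Lemma pos_support_successor (c : 'I_k -> R) i : \sum_j c j *: m j = 0 ->
  0 < c i -> exists2 j, 0 < c j & 0 < pairing (m j) (u i).
Proof.
move=> cm0 ci; apply: contrapT => noj.
have : \sum_j c j * pairing (m j) (u i) = 0.
  rewrite -[RHS](pairing0l (u i)) -cm0 pairing_suml.
  by apply: eq_bigr => j _; rewrite pairingZl.
apply/eqP; rewrite lt_eqF // (bigD1 i) //= diag mulrN1.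
apply: (@lt_le_trans _ _ (- c i + c i)); last by rewrite addNr.
rewrite ltrD2l; apply: le_lt_trans ci; apply: sumr_le0 => j ji.
have [cj|cj] := ltP 0 (c j).
  rewrite pmulr_rle0 // leNgt; apply/negP => aij; apply: noj; by exists j.
by rewrite mulr_le0_ge0 // offdiag_ge0 // eq_sym.
Qed.

(** By integrality a positive pairing is at least 1 and makes up for the diagonal entry -1. *)
Lemma successor_closed_sum0 (S : {set 'I_k}) :
  (forall i, i \in S -> exists2 j, j \in S & 0 < pairing (m j) (u i)) ->
  \sum_(j in S) m j = 0.
Proof.
move=> succ; apply: nonneg_sum0 => i; have [iS|iS] := boolP (i \in S).
  have [j jS aij] := succ i iS.
  have ji : j != i by apply: contraTneq aij => ->; rewrite diag oppr_gt0 ltr10.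
  rewrite (bigD1 i) //= diag (bigD1 j) /=; last by rewrite jS.
  rewrite addrA addr_ge0 ?sumr_ge0 //.
    by rewrite addrC subr_ge0 -[1]add0r intr_ltD1.
  by move=> l /andP[/andP[_ li] _]; rewrite offdiag_ge0 // eq_sym.
by apply: sumr_ge0 => j jS; apply: offdiag_ge0; apply: contraNneq iS => ->.
Qed.

Lemma pos_support_sum0 (c : 'I_k -> R) : \sum_j c j *: m j = 0 ->
  \sum_(j in [set j | 0 < c j]%SET) m j = 0.
Proof.
move=> cm0; apply: successor_closed_sum0 => i; rewrite inE => ci.
have [j cj aij] := pos_support_successor cm0 ci.
by exists j => //; rewrite inE.
Qed.

Lemma sum_indicator (S : {set 'I_k}) :
  \sum_(j in S) m j = \sum_j (j \in S)%:R *: m j.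
Proof.
rewrite big_mkcond; apply: eq_bigr => j _.
by case: (j \in S); rewrite ?scale1r ?scale0r.
Qed.

(** The indicators of [S] and [S'] add up to those of union and intersection. The union is the
    positive support of this sum, hence zero-sum, and subtracting it leaves the intersection. *)
Lemma setI_sum0 (S S' : {set 'I_k}) :
  \sum_(j in S) m j = 0 -> \sum_(j in S') m j = 0 ->
  \sum_(j in S :&: S') m j = 0.
Proof.
rewrite !sum_indicator => S0 S'0.
have sumE : \sum_j ((j \in S)%:R + (j \in S')%:R) *: m j = 0.
  by under eq_bigr do rewrite scalerDl; rewrite big_split /= S0 S'0 addr0.
have := pos_support_sum0 sumE; rewrite sum_indicator => U0.
rewrite -[LHS]addr0 -[X in _ + X]U0 -[RHS]sumE -big_split; apply: eq_bigr => j _ /=.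
rewrite -scalerDl; congr (_ *: _); rewrite !inE.
by case: (j \in S); case: (j \in S');
  rewrite /= ?addr0 ?add0r ?ltxx ?ltr01 ?ltr0n // addr_gt0.
Qed.

(** Boolean, so that a maximal such set exists by finiteness. *)
Definition zero_sum_free (T : {set 'I_k}) :=
  [forall S : {set 'I_k}, (S \subset T) ==> (\sum_(j in S) m j == 0) ==> (S == finset.set0)].

Lemma zero_sum_freeP (T S : {set 'I_k}) : zero_sum_free T -> S \subset T ->
  \sum_(j in S) m j = 0 -> S = finset.set0.
Proof. by move=> /forallP/(_ S)/implyP fT /fT/implyP h /eqP/h/eqP. Qed.

(** The positive supports of [c] and of [- c] are zero-sum subsets of [T], hence empty. *)
Lemma zero_sum_free_independent (T : {set 'I_k}) (c : 'I_k -> R) :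
  zero_sum_free T -> (forall j, j \notin T -> c j = 0) ->
  \sum_j c j *: m j = 0 -> forall j, c j = 0.
Proof.
move=> fT cT.
have le0 (e : 'I_k -> R) : (forall j, j \notin T -> e j = 0) ->
    \sum_j e j *: m j = 0 -> forall j, e j <= 0.
  move=> eT e0 j; rewrite leNgt; apply/negP => ej.
  have sub : [set l | 0 < e l]%SET \subset T.
    by apply/fintype.subsetP => l; rewrite inE; apply: contraTT => /eT ->; rewrite ltxx.
  have /finset.setP/(_ j) := zero_sum_freeP fT sub (pos_support_sum0 e0).
  by rewrite !inE ej.
move=> c0 j; apply/eqP; rewrite eq_le le0 //= -oppr_le0 (le0 (fun j => - c j)) //.
  by move=> l /cT ->; rewrite oppr0.
by under eq_bigr do rewrite scaleNr; rewrite sumrN c0 oppr0.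
Qed.

Lemma zero_sum_free_card (T : {set 'I_k}) : zero_sum_free T -> (#|T| <= d)%N.
Proof.
move=> fT; pose A : 'M[R]_(#|T|, d) := \matrix_i m (enum_val i).
suff : row_free A by rewrite -row_leq_rank => /leq_trans; apply; apply: rank_leq_col.
apply: inj_row_free => v vA; apply/rowP => i; rewrite mxE.
(* This extends [v] by zero to all indices; the fibres of [enum_val] have at most one element. *)
pose c j : R := \sum_(i | enum_val i == j :> 'I_k) v 0 i.
have ci : c (enum_val i) = v 0 i.
  by rewrite /c (eq_bigl (pred1 i)) ?big_pred1_eq // => l; rewrite (inj_eq enum_val_inj).
rewrite -ci; apply: (zero_sum_free_independent fT) => [j jT|].
  by rewrite /c big1 // => l /eqP lj; rewrite -lj enum_valP in jT.
rewrite -[RHS]vA mulmx_sum_row [RHS](partition_big (@enum_val _ _) predT) //=.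
apply: eq_bigr => j _; rewrite scaler_suml; apply: eq_bigr => l /eqP <-.
by rewrite rowK.
Qed.

(* The zero-sum sets witnessing the maximality of [T] pairwise intersect in
   zero-sum subsets of [T], so they are disjoint: this is an injection of the
   complement of [T] into [T]. *)
Lemma maximal_zero_sum_free : exists T : {set 'I_k},
  [/\ (#|T| <= d)%N, (k <= 2 * #|T|)%N &
      k = (2 * #|T|)%N ->
      forall j, j \in T -> exists2 i, i \notin T & m i = - m j].
Proof.
have f0 : zero_sum_free finset.set0.
  by apply/forallP => S; rewrite finset.subset0; apply/implyP => ->; rewrite implybT.
have [T /maxsetP[fT maxT] _] := maxset_exists f0.
exists T.
have /choice[S SP] : forall i, exists S : {set 'I_k}, i \notin T ->
    [/\ i \in S, S \subset i |: T & \sum_(j in S) m j = 0].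
  move=> i; have [iT|iT] := boolP (i \in T); first by exists finset.set0.
  (* By maximality [i |: T] has a nonempty zero-sum subset; it contains [i] because [T] has none. *)
  have /existsP[S] : [exists S : {set 'I_k}, ~~ ((S \subset i |: T) ==>
     (\sum_(j in S) m j == 0) ==> (S == finset.set0))].
    rewrite -negb_forall; apply: contra iT => /maxT <-; first by rewrite finset.setU11.
    exact: finset.subsetU1.
  rewrite !negb_imply => /and3P[ST /eqP S0 Sn0]; exists S => _; split=> //.
  apply: contraNT Sn0 => iS; apply/eqP/(zero_sum_freeP fT) => //.
  apply/fintype.subsetP => j jS; have := fintype.subsetP ST _ jS; rewrite !inE => /orP[/eqP ji|//].
  by rewrite -ji jS in iS.
have disj i j l : i \notin T -> j \notin T -> l \in S i -> l \in S j -> i = j.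
  move=> iT jT li lj; apply/eqP; apply: contraT => ij.
  have [iS SiT Si0] := SP i iT; have [jS SjT Sj0] := SP j jT.
  have sub : S i :&: S j \subset T.
    apply/fintype.subsetP => x; rewrite inE.
    move=> /andP[/(fintype.subsetP SiT) + /(fintype.subsetP SjT)].
    by rewrite !inE => /orP[/eqP ->|//]; rewrite (negPf ij) (negPf iT).
  have /finset.setP/(_ l) := zero_sum_freeP fT sub (setI_sum0 Si0 Sj0).
  by rewrite !inE li lj.
have /choice[g gP] : forall i, exists j, i \notin T -> j \in T /\ j \in S i.
  move=> i; have [iT|iT] := boolP (i \in T); first by exists i.
  have [iS SiT Si0] := SP i iT.
  (* If [S i] were the singleton of [i], then [m i = 0], against [diag]. *)
  have [/set0Pn[j]|] := boolP (S i :\ i != finset.set0).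
    rewrite !inE => /andP[ji jS]; exists j => _; split=> //.
    by have := fintype.subsetP SiT _ jS; rewrite !inE (negPf ji).
  rewrite negbK => /eqP Si; have := congr1 (fun x => pairing x (u i)) Si0.
  rewrite (finset.big_setD1 i) //= Si finset.big_set0 addr0 diag pairing0l.
  by move/eqP; rewrite oppr_eq0 oner_eq0.
have ginj : {in ~: T &, injective g}.
  move=> i j; rewrite !inE => iT jT gij.
  have [_ gi] := gP i iT; have [_ gj] := gP j jT.
  by apply: (disj i j (g i)) => //; rewrite gij.
have gT : (g @: (~: T))%SET \subset T.
  by apply/fintype.subsetP => _ /imsetP[i + ->]; rewrite inE => /gP[].
have cg := card_in_imset ginj.
have cT : (#|T| + #|~: T| = k)%N by rewrite cardsC card_ord.
have cTC : (#|~: T| <= #|T|)%N by rewrite -cg subset_leq_card.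
split; first exact: zero_sum_free_card.
  by rewrite -[leqLHS]cT mul2n -addnn leq_add2l.
move=> kT; have gTE : (g @: (~: T))%SET = T.
  apply/eqP; rewrite eqEcard gT cg -(leq_add2l #|T|) cT [leqRHS]kT mul2n -addnn.
  exact: leqnn.
move=> j; rewrite -gTE => /imsetP[i]; rewrite inE => iT ->; exists i; rewrite ?gTE //.
have [iS SiT Si0] := SP i iT; have [giT giS] := gP i iT.
(* As [g] is onto [T], any [x] in [S i] other than [i] is some [g l] in [S l], and disjointness
   gives [l = i]. *)
have SiE : S i = [set i; g i]%SET.
  apply/finset.setP => x; rewrite !inE; apply/idP/orP; last by case=> /eqP ->.
  move=> xS; have := fintype.subsetP SiT _ xS; rewrite !inE => /orP[->|]; first by left.
  rewrite -{1}gTE => /imsetP[l]; rewrite inE => lT xE; right.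
  have [_ glS] := gP l lT; rewrite xE (disj i l x) // xE //.
move: Si0; rewrite SiE finset.big_setU1 ?finset.big_set1 /=.
  by move/eqP; rewrite addr_eq0 => /eqP.
by rewrite inE; apply: contraNneq iT => ->.
Qed.

End ZeroSums.

(** * Facets of a reflexive polytope *)

Section Facets.
Variables (R : realType) (d : nat).
Implicit Types (x y u v w : 'rV[R]_d) (P F V N : set 'rV[R]_d).

(** The affine hull of a facet is a hyperplane missing 0, so its equation can be scaled to the value
    -1, and then its normal [u] is unique. *)
Lemma facet_normal P F : interior P 0 -> is_facet P F ->
  exists u, [/\ forall x, P x -> -1 <= pairing x u,
    F = [set x | P x /\ pairing x u = -1] &
    forall w, (forall x, F x -> pairing x w = -1) -> w = u].
Proof.
move=> P0 [[u0 [c [Pc FE]]] [k [kd [p [A [freeA hullF]]]]]].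
have rkA : \rank A = k by move/eqP: freeA.
(* If [c = 0], then [u0] is nonpositive near 0, so [u0 = 0] and [F = P], whose affine hull is the
   whole space and not of dimension [k]. *)
have c0 : 0 < c.
  rewrite lt_neqAle -[X in X <= c](pairing0l u0) Pc ?andbT; last exact: nbhs_singleton P0.
  apply/negP => /eqP c0; subst c.
  have u00 : u0 = 0.
    apply: pairing_self_le0; have [e e0 Pe] := near_line u0 P0.
    by have := Pc _ Pe; rewrite add0r pairingZl pmulr_rle0.
  have FP : F = P.
    rewrite FE u00; apply/seteqP; split=> x /=; first by case.
    by move=> Px; rewrite pairingC pairing0l.
  have hullT x : affine_hull F x.
    rewrite FP; have [e e0 Pe] := near_line x P0.
    have := affine_hull_line e^-1 (nbhs_singleton P0) Pe.
    by rewrite !add0r subr0 scalerA mulVf ?gt_eqF // scale1r.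
  have := hullT 0; rewrite hullF => -[v /= vA pv0].
  have pA : (p <= A)%MS.
    by have -> : p = - v; [apply/eqP; rewrite -addr_eq0 pv0 | rewrite eqmx_opp].
  have /mxrankS : (1%:M <= A)%MS.
    apply/row_subP => i; have := hullT (row i 1%:M); rewrite hullF => -[v' /= v'A <-].
    exact: addmx_sub.
  by rewrite rkA mxrank1 -kd ltnn.
pose u := - c^-1 *: u0.
have Fu x : F x -> pairing x u = -1.
  by rewrite FE => -[_ xu]; rewrite pairingZr xu mulNr mulVf ?gt_eqF.
exists u; split.
- move=> x Px; rewrite pairingZr mulNr lerN2 mulrC ler_pdivrMr // mul1r; exact: Pc.
- rewrite {1}FE; apply/seteqP; split=> x /= [Px xu]; split=> //.
    by rewrite pairingZr xu mulNr mulVf ?gt_eqF.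
  by move/eqP: xu; rewrite pairingZr mulNr eqr_opp mulrC => /eqP/divr1_eq.
move=> w Fw.
have hp z a v : (forall x, F x -> pairing x z = a) -> (v <= A)%MS ->
    pairing p z = a /\ pairing v z = 0.
  move=> /pairing_affine_hull; rewrite hullF => Fz vA.
  have pz : pairing p z = a by apply: Fz; exists 0; rewrite /= ?sub0mx ?addr0.
  have /eqP := Fz (p + v) (ex_intro2 _ _ v vA erefl).
  by rewrite pairingDl pz -subr_eq0 addrAC subrr add0r => /eqP.
(* [u] is -1 at [p] and 0 on the rows of [A], so [p] lies outside their span. As [k.+1 = d], these
   vectors form a basis, on which [w] and [u] agree. *)
have freeAp : row_free (col_mx A p).
  apply: inj_row_free => r; rewrite -(hsubmxK r) mul_row_col => rAp.
  have r2 : rsubmx r = 0.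
    have [pu Au] := hp u (-1) (lsubmx r *m A) Fu (submxMl _ _).
    move: rAp; rewrite [rsubmx r]mx11_scalar mul_scalar_mx => /(congr1 (fun x => pairing x u)).
    rewrite pairing0l pairingDl pairingZl pu Au add0r mulrN1 => /eqP.
    by rewrite oppr_eq0 => /eqP ->; rewrite raddf0.
  move: rAp; rewrite r2 mul0mx addr0 => /(congr1 (mulmx^~ (pinvmx A))).
  by rewrite mul0mx -mulmxA mulmxVp // mulmx1 => ->; rewrite row_mx0.
have fullAp : row_full (col_mx A p) by rewrite /row_full (eqP freeAp) addn1 kd.
apply/eqP; rewrite -subr_eq0 -trmx_eq0; apply/eqP/(row_full_inj fullAp).
rewrite mulmx0 mul_col_mx -[RHS]col_mx0; congr col_mx.
  apply/matrixP => i j; rewrite ord1 [RHS]mxE.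
  have [_ +] := hp w _ (row i A) Fw (row_sub _ _).
  have [_ +] := hp u _ (row i A) Fu (row_sub _ _).
  move=> Au Aw; have : pairing (row i A) (w - u) = 0 by rewrite pairingBr Au Aw subrr.
  by rewrite pairing_mulmx -row_mul mxE => ->.
apply/matrixP => i j; rewrite !ord1 -pairing_mulmx pairingBr mxE.
have [-> _] := hp w _ 0 Fw (sub0mx _ _); have [-> _] := hp u _ 0 Fu (sub0mx _ _).
by rewrite subrr.
Qed.

(** From [m] one can step slightly away from any [x] in [F] without leaving [F]; if the value at [x]
    exceeded [c], this step would go below [c]. *)
Lemma relative_interior_min F m w (c : R) : relative_interior F m ->
  (forall x, F x -> c <= pairing x w) -> pairing m w = c ->
  forall x, F x -> pairing x w = c.
Proof.
move=> [hm Fm] Fc mw x Fx; apply/eqP; rewrite eq_le Fc // andbT.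
have mF : F m by exact: nbhs_singleton Fm hm.
have [e e0 Fe] := near_line (m - x) Fm.
have /Fe/Fc : affine_hull F (m + e *: (m - x)).
  by rewrite -(opprB x m) scalerN -scaleNr; apply: affine_hull_line.
by rewrite pairingDl pairingZl pairingBl mw lerDl pmulr_rge0 // subr_ge0.
Qed.

(** [P] is bounded, so its polar contains a small negative multiple of [x]. That point pairs
    nonnegatively with [x], which forces [x = 0]. *)
Lemma polar_nonneg_eq0 P V V' x : finite_set V' -> P = convex_hull V' ->
  polar_dual P = convex_hull V -> (forall w, V w -> 0 <= pairing x w) -> x = 0.
Proof.
move=> /finite_seqP[s ->] -> polE xV; apply: pairing_self_le0.
pose B := 1 + \sum_(v <- s) `|pairing v x|.
have B0 : 0 < B by rewrite ltr_pwDl // sumr_ge0.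
have : convex_hull V (- B^-1 *: x).
  rewrite -polE; apply: pairing_convex_hull => v /= vs.
  rewrite pairingZr mulNr lerN2 ler_pdivrMl // mulr1.
  apply: le_trans (ler_norm _) _.
  rewrite /B (perm_big _ (perm_to_rem vs)) big_cons addrCA lerDl addr_ge0 // sumr_ge0 //.
move=> /(pairing_convex_hull (u := x) (c := 0)).
rewrite pairingZl mulNr oppr_ge0 pmulr_rle0 ?invr_gt0 //; apply=> w.
by rewrite pairingC; apply: xV.
Qed.

(** The normal [u] is a convex combination of points of [V]; one with positive weight is -1 on all
    of [F], so it equals [u]. Any other [w] in [V] is not -1 at [m], or it would be -1 on [F];
    integrality then raises the bound -1 to 0. *)
Lemma facet_vertex N P V F m : interior P 0 -> polar_dual P = convex_hull V ->
  V `<=` N -> dual_lattice N m -> is_facet P F -> relative_interior F m ->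
  exists u, [/\ V u, F = [set x | P x /\ pairing x u = -1], pairing m u = -1 &
    forall w, V w -> w != u -> 0 <= pairing m w].
Proof.
move=> P0 polE VN Mm facetF Fm.
have [u [Pu FE uniq_u]] := facet_normal P0 facetF.
have VP w x : V w -> P x -> -1 <= pairing x w.
  by move=> /sub_convex_hull; rewrite -polE; apply.
have mF : F m by have [? /nbhs_singleton] := Fm; apply.
have mu : pairing m u = -1 by move: mF; rewrite FE => -[].
have Pm : P m by move: mF; rewrite FE => -[].
exists u; split=> //.
- have : convex_hull V u by rewrite -polE.
  move=> [n [p [a [Vp a0 a1 uE]]]].
  have /existsP[i ai] : [exists i, 0 < a i].
    apply: contraT; rewrite negb_exists => /forallP na.
    have := oner_neq0 R; rewrite -a1 big1 ?eqxx // => i _.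
    by apply/eqP; rewrite eq_le a0 andbT leNgt na.
  rewrite -(uniq_u (p i)) // => x; rewrite FE /= => -[Px xu].
  (* These nonnegative terms add up to [1 + pairing x u], which vanishes on [F]. *)
  have : \sum_j a j * (1 + pairing x (p j)) == 0.
    under eq_bigr => j _ do rewrite mulrDr mulr1 -pairingZr.
    by rewrite big_split /= a1 -pairing_sumr -uE xu subrr.
  rewrite psumr_eq0 => [/allP/(_ i (mem_index_enum i))|j _].
    by rewrite mulf_eq0 gt_eqF //= addrC addr_eq0 => /eqP.
  by rewrite mulr_ge0 // addrC -lerBlDr sub0r VP.
- move=> w Vw wu; have mwZ : pairing m w \is a Num.int by apply: Mm; apply: VN.
  have mw : -1 <= pairing m w by exact: VP.
  have mw1 : pairing m w != -1.
    apply: contra wu => /eqP mw1; apply/eqP/uniq_u.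
    by apply: relative_interior_min Fm _ mw1 => x; rewrite FE => -[Px _]; apply: VP.
  by rewrite -(addNr 1) intr_ltD1 ?rpredN ?rpred1 // lt_neqAle eq_sym mw1.
Qed.

End Facets.

(** * Recognizing the cube *)

Section DualBases.
Variables (R : realType) (d : nat) (q w : 'I_d -> 'rV[R]_d).
Hypothesis dual : forall i j, pairing (q i) (w j) = (i == j)%:R.
Implicit Types (x y v : 'rV[R]_d) (N P V : set 'rV[R]_d).

Lemma dual_pairing_sum (y : 'I_d -> R) i : pairing (\sum_j y j *: q j) (w i) = y i.
Proof.
rewrite pairing_suml (bigD1 i) //= pairingZl dual eqxx mulr1 big1 ?addr0 // => j ji.
by rewrite pairingZl dual (negPf ji) mulr0.
Qed.

Lemma dual_basis_expansion x : x = \sum_j pairing x (w j) *: q j.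
Proof.
pose Q := \matrix_j q j; pose W := \matrix_j w j.
have : Q *m W^T = 1%:M.
  by apply/matrixP => i j; rewrite [RHS]mxE -dual mxE; apply: eq_bigr => l _; rewrite !mxE.
move/mulmx1C => WQ; rewrite -[LHS]mulmx1 -WQ mulmxA mulmx_sum_row.
by apply: eq_bigr => j _; rewrite -pairing_row !rowK.
Qed.

Lemma dual_basis_ext x y : (forall i, pairing x (w i) = pairing y (w i)) -> x = y.
Proof.
move=> xy; rewrite (dual_basis_expansion x) (dual_basis_expansion y).
by apply: eq_bigr => i _; rewrite xy.
Qed.

End DualBases.

(** Induction on the number [n] of leading coordinates allowed to differ from 1 and -1: the last of
    them is replaced by 1 and by -1, and [y] lies between the two results. *)
Lemma cube_sub_sign_hull (R : realType) (d : nat) (K : set 'rV[R]_d) :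
  (forall x y (t : R), 0 <= t <= 1 -> K x -> K y -> K (t *: x + (1 - t) *: y)) ->
  (forall s : 'rV[R]_d, (forall j, s 0 j = 1 \/ s 0 j = -1) -> K s) ->
  @cube R d `<=` K.
Proof.
move=> convK signK.
suff H n y : cube y -> (forall j : 'I_d, (n <= j)%N -> y 0 j = 1 \/ y 0 j = -1) -> K y.
  by move=> y cy; apply: (H d y cy) => j; rewrite leqNgt ltn_ord.
elim: n y => [|n IHn] y cy sy; first by apply: signK => j; apply: sy.
have [nd|dn] := ltnP n d; last first.
  by apply: IHn => // j nj; apply: sy; rewrite ltn_neqAle nj andbT (gtn_eqF (leq_trans _ dn)).
pose i := Ordinal nd.
pose z c : 'rV[R]_d := \row_j if j == i then c else y 0 j.
have Kz c : c = 1 \/ c = -1 -> K (z c).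
  move=> c1; apply: IHn => j; rewrite mxE; case: eqP => // ji.
  - by case: c1 => ->; lra.
  - move=> nj; apply: sy; rewrite ltn_neqAle nj andbT.
    by apply/negP => /eqP nj'; apply: ji; apply: val_inj.
have /andP[yi1 yi2] := cy i.
have -> : y = ((1 + y 0 i) / 2) *: z 1 + (1 - (1 + y 0 i) / 2) *: z (-1).
  apply/rowP => j; rewrite !mxE; case: eqP => [->|_]; lra.
by apply: convK; [apply/andP; split; lra | apply: Kz; left | apply: Kz; right].
Qed.

Section CubeRecognition.
Variables (R : realType) (d : nat) (q w : 'I_d -> 'rV[R]_d).
Variables N P V V' : set 'rV[R]_d.
Hypothesis dual : forall i j, pairing (q i) (w j) = (i == j)%:R.
Hypothesis Mq : forall i, dual_lattice N (q i).
Hypothesis Nw : forall i, N (w i).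
Hypothesis PE : P = convex_hull V'.
Hypothesis VM : V' `<=` dual_lattice N.
Hypothesis P0 : P 0.
Hypothesis polarE : polar_dual P = convex_hull V.
(** The first alternative amounts to [v = 0]: [V] generates the polar dual but may contain points
    other than its vertices. *)
Hypothesis Vw : forall v, V v ->
  (forall j, pairing (q j) v = 0) \/ exists j, v = w j \/ v = - w j.
Hypothesis Pw : forall x i, P x -> -1 <= pairing x (w i) <= 1.

(* Otherwise every vertex [v] of [P] has [\sum_j s j * pairing v (w j) <= d - 1]
   by integrality, which puts a point of l1-norm > 1 in the polar of [P],
   contained in the cross-polytope spanned by the [w j]. *)
Lemma cube_vertex_in (s : 'I_d -> R) : (forall j, s j = 1 \/ s j = -1) ->
  P (\sum_j s j *: q j).
Proof.
move=> s1; set x := \sum_j _.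
have [d0|d0] := posnP d.
  suff -> : x = 0 by [].
  by apply/rowP => i; have := ltn_ord i; rewrite [X in (_ < X)%N]d0.
apply: contrapT => Px.
have V'sum v : V' v -> \sum_j s j * pairing v (w j) <= d%:R - 1.
  move=> V'v; have Pv : P v by rewrite PE; apply: sub_convex_hull.
  (* [v] differs from [x] in some coordinate [i]; there [s i * pairing v (w i)] is an integer below
     1, so at most 0. *)
  have /existsP[i si] : [exists i, pairing v (w i) != s i].
    apply: contraT; rewrite negb_exists => /forallP vs; exfalso; apply: Px.
    suff -> : x = v by [].
    apply: (dual_basis_ext dual) => i; rewrite dual_pairing_sum //.
    by have := vs i; rewrite negbK => /eqP.
  have vZ : pairing v (w i) \is a Num.int by apply: VM.
  have vle j : s j * pairing v (w j) <= 1.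
    by have /andP[] := Pw j Pv; case: (s1 j) => ->; lra.
  rewrite (bigD1 i) //= -[leRHS]add0r lerD //.
    rewrite -(lerD2r 1) add0r intr_ltD1 //.
    + by case: (s1 i) => ->; rewrite rpredM ?rpredN ?rpred1.
    + rewrite lt_neqAle vle andbT; case: (s1 i) si => ->; rewrite ?mul1r //.
      by apply: contra; rewrite mulN1r eqr_oppLR.
  apply: (@le_trans _ _ (\sum_(j | j != i) 1)); first exact: ler_sum.
  by rewrite sumr_const cardC1 card_ord -subn1 natrB.
(* Chosen so that [t * (d - 1) <= 1 < t * d]: the first keeps the point in the polar, the second
   puts it outside the cross-polytope. *)
pose t : R := (d%:R - 2^-1)^-1.
have d1 : 1 <= d%:R :> R by rewrite ler1n.
have t0 : 0 < d%:R - 2^-1 :> R by lra.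
have : convex_hull V (- t *: \sum_j s j *: w j).
  rewrite -polarE => v; rewrite PE; apply: pairing_convex_hull => {}v V'v.
  rewrite pairingZr mulNr lerN2 mulrC ler_pdivrMr // mul1r pairing_sumr.
  under eq_bigr do rewrite pairingZr.
  apply: le_trans (V'sum v V'v) _; lra.
move=> /(pairing_convex_hull (u := x) (c := -1)).
have -> : pairing (- t *: \sum_j s j *: w j) x = - (d%:R / (d%:R - 2^-1)).
  rewrite pairingC pairingZr mulNr mulrC pairing_sumr; congr (- (_ * _)).
  rewrite -[d in RHS]card_ord -sumr_const; apply: eq_bigr => j _.
  by rewrite pairingZr dual_pairing_sum //; case: (s1 j) => ->; rewrite ?mulrNN mulr1.
rewrite lerN2 ler_pdivrMr // mul1r => H.
suff : d%:R <= d%:R - 2^-1 :> R by lra.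
apply: H => v /Vw[q0|[j [->|->]]].
- rewrite pairingC pairing_suml big1 ?lerN10 // => j _.
  by rewrite pairingZl q0 mulr0.
- by rewrite pairingC dual_pairing_sum //; case: (s1 j) => ->; lra.
- by rewrite pairingC pairingNr dual_pairing_sum //; case: (s1 j) => ->; lra.
Qed.

Lemma dual_bases_cube_iso : polytope_iso (dual_lattice N) P (@std_lattice R d) (@cube R d).
Proof.
pose W := \matrix_j w j; pose Q := \matrix_j q j.
have fE x i : (x *m W^T) 0 i = pairing x (w i) by rewrite -pairing_row rowK.
have gE y : y *m Q = \sum_j y 0 j *: q j.
  by rewrite mulmx_sum_row; apply: eq_bigr => j _; rewrite rowK.
have fK : cancel (mulmxr W^T : 'rV_d -> 'rV_d) (mulmxr Q).
  move=> x; rewrite /= gE [RHS](dual_basis_expansion dual); apply: eq_bigr => j _.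
  by rewrite fE.
have gK : cancel (mulmxr Q : 'rV_d -> 'rV_d) (mulmxr W^T).
  by move=> y; apply/rowP => i; rewrite /= fE gE dual_pairing_sum.
exists (mulmxr W^T); split.
- by exists (mulmxr Q).
- apply/seteqP; split=> [_ [x Mx <-] i|y yZ].
    by rewrite /= fE; apply: Mx.
  exists (y *m Q); last exact: gK.
  move=> z Nz; rewrite gE pairing_suml rpred_sum // => j _.
  by rewrite pairingZl rpredM ?Mq.
- apply/seteqP; split=> [_ [x Px <-] i|y cy].
    by rewrite /= fE; apply: Pw.
  exists (y *m Q); last exact: gK.
  move: y cy; apply: cube_sub_sign_hull => [x y t t01 Px Py|s s1].
    by rewrite mulmxDl -!scalemxAl PE; apply: convex_hull_segment; rewrite -?PE.
  by rewrite /= gE; apply: cube_vertex_in.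
Qed.

End CubeRecognition.

(** * Facets of the cube *)

(** The [w i] represent the coordinate functions of the isomorphism; the [q i] are the preimages of
    the standard basis vectors. *)
Lemma polytope_iso_cube_coords (R : realType) (d : nat) (N P : set 'rV[R]_d) :
  polytope_iso (dual_lattice N) P (@std_lattice R d) (@cube R d) ->
  exists q w : 'I_d -> 'rV[R]_d,
    [/\ forall i j, pairing (q i) (w j) = (i == j)%:R,
        forall i, dual_lattice N (q i) &
        forall x, P x <-> forall i, -1 <= pairing x (w i) <= 1].
Proof.
case=> f [[g fK gK] fM fP].
pose w i := row i (lin1_mx f)^T.
have fE x i : f x 0 i = pairing x (w i).
  by rewrite pairing_row trmxK mul_rV_lin1.
exists (fun i => g (delta_mx 0 i)), w; split=> [i j|i|x].
- by rewrite -fE gK mxE eqxx eq_sym.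
- have : std_lattice (delta_mx 0 i : 'rV[R]_d) by move=> j; rewrite mxE rpred_nat.
  by rewrite -fM => -[x Mx <-]; rewrite fK.
- split=> [Px i|cx].
    have : cube (f x) by rewrite -fP; exists x.
    by move=> /(_ i); rewrite fE.
  have : cube (f x) by move=> i; rewrite fE.
  by rewrite -fP => -[y Py /(can_inj fK) <-].
Qed.

(** At [q i] all coordinates but the [i]-th are 0, so the other inequalities are strict and persist
    nearby: a neighbourhood of [q i] within the hyperplane lies in [F]. *)
Lemma cube_facet (R : realType) (d : nat) (P : set 'rV[R]_d.+1)
    (q w : 'I_d.+1 -> 'rV[R]_d.+1) i :
  (forall i j, pairing (q i) (w j) = (i == j)%:R) ->
  (forall x, P x <-> forall i, -1 <= pairing x (w i) <= 1) ->
  let F := [set x | P x /\ pairing x (w i) = 1] in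
  [/\ is_facet P F, F (q i) & relative_interior F (q i)].
Proof.
move=> dual PE F.
have nearF : \forall y \near q i, pairing y (w i) = 1 -> F y.
  have : \forall y \near q i, forall j, i != j -> -1 <= pairing y (w j) <= 1.
    have nbhsF : Filter (nbhs (q i)) := nbhs_filter _.
    apply: (@filter_forall _ _ (fun j y => i != j -> -1 <= pairing y (w j) <= 1) _ nbhsF) => j.
    have [_|ij] := eqVneq i j; first by apply: nearW => y.
    have lt1 : \forall y \near q i, pairing y (w j) < 1.
      by apply: near_pairing_lt; rewrite dual (negPf ij).
    have gtN1 : \forall y \near q i, pairing y (- w j) < 1.
      by apply: near_pairing_lt; rewrite pairingNr dual (negPf ij) oppr0.
    near=> y => _; apply/andP; split; last by apply: ltW; near: y.
    by rewrite lerNl -pairingNr; apply: ltW; near: y.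
  apply: filterS => y ylt yi; split=> //; apply/PE => j.
  by have [<-|/ylt//] := eqVneq i j; rewrite yi lexx andbT; lra.
have qi : pairing (q i) (w i) = 1 by rewrite dual eqxx.
have Fq : F (q i) by apply: (nbhs_singleton nearF).
have hullF x : affine_hull F x <-> pairing x (w i) = 1.
  split; first by apply: pairing_affine_hull => y [].
  move=> xi; have [e e0] := near_line (x - q i) nearF.
  rewrite pairingDl pairingZl pairingBl xi qi subrr mulr0 addr0 => /(_ erefl) Fe.
  have := affine_hull_line e^-1 Fq Fe.
  by rewrite addrAC subrr add0r scalerA mulVf ?gt_eqF // scale1r addrC subrK.
split=> //; last first.
  split; first exact/hullF.
  by apply: filterS nearF => y Fy /hullF.
split; first by exists (w i), 1; split=> // x /PE/(_ i)/andP[].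
exists d; split=> //.
pose A := \matrix_j q (lift i j).
exists (q i), A; split.
  apply/row_freeP; exists (\matrix_j w (lift i j))^T; apply/matrixP => a b.
  rewrite mxE [RHS]mxE -(inj_eq (@lift_inj _ i)) -dual.
  by apply: eq_bigr => l _; rewrite !mxE.
apply/seteqP; split=> [x /hullF xi|_ [v /submxP[c ->] <-]].
  exists (x - q i); last by rewrite /= addrC subrK.
  rewrite /= (dual_basis_expansion dual (x - q i)); apply: summx_sub => j _.
  have [a ->|->] := unliftP i j.
    by apply: scalemx_sub; rewrite -[q _](rowK (fun j => q (lift i j))) row_sub.
  by rewrite pairingBl xi qi subrr scale0r sub0mx.
apply/hullF; rewrite pairingDl qi mulmx_sum_row pairing_suml big1 ?addr0 // => a _.
by rewrite rowK pairingZl dual eq_sym (negPf (neq_lift _ _)) mulr0.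
Unshelve. all: by end_near.
Qed.

Lemma cube_facets_card (R : realType) (d : nat) (N P : set 'rV[R]_d) :
  polytope_iso (dual_lattice N) P (@std_lattice R d) (@cube R d) ->
  `I_(2 * d) #<= facets_with_interior_lattice_points (dual_lattice N) P.
Proof.
case: d N P => [|d] N P; first by rewrite muln0 II0 card_ge0.
move=> /polytope_iso_cube_coords[q [w [dual Mq PE]]].
have sgn_inj (b b' : bool) : (-1) ^+ b * ((-1) ^+ b' * true%:R) = 1 :> R -> b = b'.
  by case: b b' => -[]; rewrite ?expr1 ?expr0 //= => ?; exfalso; lra.
(* A number [n] below [2 * d.+1] encodes a facet: [n./2] is the coordinate and the parity of [n] the
   sign. *)
pose ix n : 'I_d.+1 := inord n./2.
pose F n := [set x | P x /\ pairing x ((-1) ^+ odd n *: w (ix n)) = 1].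
have FP n : [/\ is_facet P (F n), F n ((-1) ^+ odd n *: q (ix n))
    & relative_interior (F n) ((-1) ^+ odd n *: q (ix n))].
  (* Changing the sign of both bases keeps them dual and leaves the cube unchanged. *)
  apply: (cube_facet (q := fun i => (-1) ^+ odd n *: q i)
    (w := fun i => (-1) ^+ odd n *: w i)) => [i j|x].
    by rewrite pairingZl pairingZr mulrA -expr2 sqrr_sign mul1r.
  rewrite PE; split=> cx i; have := cx i; rewrite pairingZr;
    case: (odd n); rewrite ?expr1 ?expr0 ?mul1r // => /andP[? ?]; apply/andP; split; lra.
have Finj : {in `I_(2 * d.+1) &, injective F}.
  move=> n n'; rewrite !inE /= => nd nd' FF.
  (* A point of [F n] is put into the equation of [F n']: it gives 0 for different coordinates and
     -1 for opposite signs. *)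
  have [_ + _] := FP n; rewrite FF => -[_].
  rewrite pairingZl pairingZr dual; have [ixE|_] := eqVneq (ix n) (ix n'); last first.
    by rewrite !mulr0 => /esym/eqP; rewrite oner_eq0.
  move=> /sgn_inj sgnE; rewrite -[n]odd_double_half -[n']odd_double_half.
  have -> : n./2 = n'./2.
    by move: ixE => /(congr1 val); rewrite /= !inordK // ltn_half_double -mul2n.
  by rewrite sgnE.
have := inj_card_eq Finj; rewrite card_eq_sym card_eq_le => /andP[/card_le_trans + _]; apply.
apply: subset_card_le => _ [n _ <-]; have [facetF _ intF] := FP n; split=> //.
exists ((-1) ^+ odd n *: q (ix n)) => // y Ny.
by rewrite pairingZl rpredM ?Mq // rpredX // rpredN1.
Qed.

(** * Indexing the facets, and the theorem *)

(** A facet is determined by its normal, which lies in the finite set [V]; so the facets are finite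
    in number and can be indexed. *)
Lemma interior_facets_enum (R : realType) (d : nat) (N P V : set 'rV[R]_d) :
  finite_set V -> V `<=` N -> interior P 0 -> polar_dual P = convex_hull V ->
  exists k (u m : 'I_k -> 'rV[R]_d),
    facets_with_interior_lattice_points (dual_lattice N) P #= `I_k /\
    [/\ forall i, V (u i), forall i, dual_lattice N (m i),
        forall i, pairing (m i) (u i) = -1,
        forall i w, V w -> w != u i -> 0 <= pairing (m i) w &
        injective u].
Proof.
move=> finV VN P0 polE; set facets := facets_with_interior_lattice_points _ _.
have /choice[h hP] : forall F, exists um : 'rV[R]_d * 'rV[R]_d, facets F ->
    [/\ V um.1, F = [set x | P x /\ pairing x um.1 = -1], dual_lattice N um.2,
        pairing um.2 um.1 = -1 & forall w, V w -> w != um.1 -> 0 <= pairing um.2 w].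
  move=> F; have [[facetF [m Mm Fm]]|nF] := pselect (facets F); last by exists 0.
  have [u [Vu FE mu mw]] := facet_vertex P0 polE VN Mm facetF Fm.
  by exists (u, m).
have hinj F F' : facets F -> facets F' -> (h F).1 = (h F').1 -> F = F'.
  by move=> /hP[_ FE _ _ _] /hP[_ F'E _ _ _] hFF'; rewrite FE F'E hFF'.
have /finite_setP[k facets_k] : finite_set facets.
  have fin_im : finite_set [set (h F).1 | F in facets].
    by apply: sub_finite_set finV => _ [F /hP[]] ? _ _ _ _ <-.
  rewrite -(eq_finite_set (@inj_card_eq _ _ facets (fun F => (h F).1) _)) //.
  by move=> F F' /set_mem fF /set_mem fF'; apply: hinj.
have /pcard_eqP/unsquash g : `I_k #= facets by rewrite card_eq_sym.
have gP (i : 'I_k) : facets (g i) by apply: funS => /=.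
have ginj (i j : 'I_k) : g i = g j -> i = j.
  move=> gij; apply: val_inj; apply: (@inj _ _ _ g) => //; by rewrite inE /=.
exists k, (fun i => (h (g i)).1), (fun i => (h (g i)).2); split=> //; split.
- by move=> i; have [] := hP _ (gP i).
- by move=> i; have [] := hP _ (gP i).
- by move=> i; have [] := hP _ (gP i).
- by move=> i; have [] := hP _ (gP i).
- by move=> i j /(hinj _ _ (gP i) (gP j))/ginj.
Qed.

Theorem corollary3p3 (R : realType) (d : nat) (N P : set 'rV[R]_d) :
  is_lattice N -> reflexive_polytope N P ->
  let M := dual_lattice N in
  let facets := facets_with_interior_lattice_points M P in
  facets #<= `I_(2 * d)%N /\
  (facets #= `I_(2 * d)%N <->
     polytope_iso M P (@std_lattice R d) (@cube R d)).
Proof.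
move=> _ [[V' [finV' V'M PE]] _ P0 [V [finV VN polE]]] M facets.
have [k [u [m [facets_k [Vu Mm mu mw uinj]]]]] := interior_facets_enum finV VN P0 polE.
have muge0 i j : i != j -> 0 <= pairing (m j) (u i).
  by move=> ij; apply: mw => //; rewrite (inj_eq uinj).
have muZ i j : pairing (m j) (u i) \is a Num.int by apply: Mm; apply: VN.
have sum0 (S : {set 'I_k}) : (forall i, 0 <= \sum_(j in S) pairing (m j) (u i)) ->
    \sum_(j in S) m j = 0.
  move=> S0; apply: (polar_nonneg_eq0 finV' PE polE) => w Vw; rewrite pairing_suml.
  have [[i ->]|nu] := pselect (exists i, w = u i); first exact: S0.
  by apply: sumr_ge0 => j _; apply: mw => //; apply/eqP => wu; apply: nu; exists j.
have [T [Td kT opp]] := maximal_zero_sum_free mu muge0 muZ sum0.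
have k2d : (k <= 2 * d)%N by rewrite (leq_trans kT) // leq_mul2l Td.
have facets_le : facets #<= `I_(2 * d).
  move: facets_k; rewrite card_eq_le => /andP[/card_le_trans + _]; apply.
  by rewrite card_le_II.
split=> //; split=> [facets_2d|/cube_facets_card facets_ge]; last first.
  by rewrite card_eq_le facets_le.
have kE : k = (2 * d)%N.
  apply/card_eq_II; apply: card_eq_trans facets_2d.
  by rewrite card_eq_sym.
have TE : #|T| = d.
  by apply/eqP; rewrite eqn_leq Td /= -(leq_pmul2l (isT : (0 < 2)%N)) -kE.
have /opp/= {}opp : k = (2 * #|T|)%N by rewrite TE.
(* [e] numbers the [d] elements of [T]; [f] below picks indices outside [T] with the opposite
   lattice points. *)
pose e (j : 'I_d) := enum_val (cast_ord (esym TE) j).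
have eT j : e j \in T by exact: enum_valP.
have einj : injective e by move=> i j /enum_val_inj/cast_ord_inj.
have /choice[f fP] : forall j, exists i, i \notin T /\ m i = - m (e j).
  by move=> j; have [i iT mi] := opp _ (eT j); exists i.
have fe i j : f i != e j by apply: contraTneq (eT j) => <-; case: (fP i).
have mf j : m (f j) = - m (e j) by case: (fP j).
(* [m (e j)] and [- m (e j)] both pair nonnegatively with the other vertices. *)
have me0 j v : V v -> v != u (e j) -> v != u (f j) -> pairing (m (e j)) v = 0.
  move=> Vv /mw ve /mw vo; apply/eqP; rewrite eq_le ve // andbT.
  by rewrite -oppr_ge0 -pairingNl -mf vo.
have dual i j : pairing (m (e i)) (- u (e j)) = (i == j)%:R.
  rewrite pairingNr; have [->|ij] := eqVneq i j; first by rewrite mu opprK.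
  by rewrite me0 ?oppr0 // (inj_eq uinj) ?(inj_eq einj) 1?eq_sym.
(* [u (f j)] is determined by its pairings with the basis [m (e i)]: 1 for [i = j], as
   [m (e j) = - m (f j)], and 0 otherwise. *)
have uf j : u (f j) = - u (e j).
  have dual' i l : pairing (- u (e i)) (m (e l)) = (i == l)%:R.
    by rewrite pairingC dual eq_sym.
  apply: (dual_basis_ext dual') => i; rewrite dual' pairingC.
  have [<-|ji] := eqVneq j i; first by rewrite -[m _]opprK -mf pairingNl mu opprK.
  (* [f j = f i] would give [m (e j) = m (e i)], against duality. *)
  rewrite me0 // (inj_eq uinj) //; apply: contra ji => /eqP fji.
  have := dual j i; rewrite -[m (e j)]opprK -mf fji mf opprK dual eqxx.
  by case: (j == i) => // /eqP; rewrite oner_eq0.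
have VP v x : V v -> P x -> -1 <= pairing x v.
  by move=> /sub_convex_hull; rewrite -polE; apply.
apply: (dual_bases_cube_iso dual _ _ PE V'M (nbhs_singleton P0) polE) => //.
- by move=> j; rewrite -uf; apply: VN.
- move=> v Vv.
  have [[j [->|->]]|nv] := pselect (exists j, v = u (e j) \/ v = u (f j)).
  + by right; exists j; right; rewrite opprK.
  + by right; exists j; left.
  + by left=> j; rewrite me0 //; apply/eqP => vE; apply: nv; exists j; [left|right].
(* The opposite normals [u (f j)] and [u (e j)] give the two bounds. *)
- move=> x j Px; rewrite -uf VP //= uf pairingNr lerNl; exact: VP.
Qed.
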